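(* Let $(\mathbf{B},\|\cdot\|)$ be a real separable Banach space. Let $\varphi,\psi:[0,\infty)\to[0,\infty)$ be two continuous and increasing functions such that $\varphi(0)=\psi(0)=0$, $\lim_{t\to\infty}\varphi(t)=\infty$, and $\frac{\psi(\cdot)}{\varphi(\cdot)}$ is a nondecreasing function on $[0,\infty)$, where $\frac{\psi(0)}{\varphi(0)}$ is defined as $\lim_{t\to 0^+}\frac{\psi(t)}{\varphi(t)}$. For $n\ge 1$, set $a_n=\varphi(n)$ and $b_n=\psi(n)$. Then: (i) If $\{x_n;\ n\ge 1\}$ is a sequence in $\mathbf{B}$ such that $\|x_n\|\le b_n$ for all $n\ge 1$, and $\{R_n;\ n\ge1\}$ is a Rademacher sequence, then for every $n\ge 1$ and all $t\ge 0$, $$\mathbb{P}\left(\left\|\sum_{i=1}^{n} R_i x_i\right\|>t b_n\right)\le 2\,\mathbb{P}\left(\left\|\sum_{i=1}^{n} R_i\,\varphi\left(\psi^{-1}(\|x_i\|)\right)\frac{x_i}{\|x_i\|}\right\|>t a_n\right).$$ (ii) If $\{V_n;\ n\ge 1\}$ is a sequence of independent and symmetric $\mathbf{B}$-valued random variables, then for every $n\ge 1$ and all $t\ge 0$, $$\mathbb{P}\left(\left\|\sum_{i=1}^{n} V_i\right\|>t b_n\right)\le 4\,\mathbb{P}\left(\left\|\sum_{i=1}^{n}\varphi\left(\psi^{-1}(\|V_i\|)\right)\frac{V_i}{\|V_i\|}\right\|>t a_n\right)+\sum_{i=1}^{n}\mathbb{P}\left(\|V_i\|>b_n\right).$$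
   Context: A $\mathbf{B}$-valued random variable is a measurable function from a probability space $(\Omega,\mathcal{F},\mathbb{P})$ into $\mathbf{B}$ equipped with its Borel $\sigma$-algebra. It is symmetric if $V$ and $-V$ have the same distribution. A Rademacher sequence is a sequence of independent and identically distributed real-valued random variables $R_n$ with $\mathbb{P}(R_n=1)=\mathbb{P}(R_n=-1)=1/2$. ''Increasing'' means strictly increasing (as opposed to ''nondecreasing''). $\psi^{-1}:[0,\infty)\to[0,\infty)$ is the inverse function of $\psi$ (under the hypotheses, $\psi$ is a bijection of $[0,\infty)$ onto itself). Convention: the expression $\varphi(\psi^{-1}(\|x\|))\frac{x}{\|x\|}$ is defined to be $0\in\mathbf{B}$ when $x=0$. *)

(* Defs.v *)
From HB Require Import structures.
From mathcomp Require Import all_boot all_order all_algebra finmap.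
From mathcomp Require Import all_classical all_reals all_analysis.

Set Implicit Arguments.
Unset Strict Implicit.
Unset Printing Implicit Defensive.

Import Order.TTheory GRing.Theory Num.Theory.
Import numFieldNormedType.Exports.

Local Open Scope classical_set_scope.
Local Open Scope ring_scope.

Notation borel B := (g_sigma_algebraType (@open B)).

Definition separable (B : topologicalType) : Prop :=
  exists S : set B, countable S /\ dense S.

Section functions_on_nonnegative_reals.
Context {R : realType}.
Implicit Types f g : R -> R.

(* A function [0, oo[ -> [0, oo[ is represented by a total function R -> R,
   of which only the values on [0, oo[ are constrained and used. *)
Definition maps_nonneg f : Prop := forall t, 0 <= t -> 0 <= f t.

Definition continuous_nonneg f : Prop := {within `[0, +oo[, continuous f}.

Definition increasing_nonneg f : Prop :=
  {in `[0, +oo[ &, {homo f : s t / s < t}}.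

Definition nondecreasing_nonneg f : Prop :=
  {in `[0, +oo[ &, {homo f : s t / s <= t}}.

Definition quotient_ext f g (t : R) : R :=
  if t == 0 then lim (f s / g s @[s --> 0^'+]) else f t / g t.

Definition inv_nonneg f : R -> R := 'pinv_(fun=> 0) `[0, +oo[ f.

(* At x = 0 the value is 0, because scaling the zero vector gives 0. *)
Definition rescale {B : normedModType R} (phi psi : R -> R) (x : B) : B :=
  phi (inv_nonneg psi `|x|) *: (`|x|^-1 *: x).

End functions_on_nonnegative_reals.

Section random_variables.
Context {R : realType} {d : measure_display} {T : measurableType d}.
Variable P : probability T R.

(* Mutual independence of the subfamily (X i)_(i in D). *)
Definition independent_family {I : choiceType} {d' : measure_display}
    {E : measurableType d'} (D : set I) (X : I -> {RV P >-> E}) : Prop :=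
  forall J : {fset I}, [set` J] `<=` D ->
  forall A : I -> set E, (forall i, i \in J -> measurable (A i)) ->
  P (\bigcap_(i in [set` J]) (X i @^-1` A i)) =
  (\prod_(i <- J) P (X i @^-1` A i))%E.

Definition identically_distributed {I : Type} {d' : measure_display}
    {E : measurableType d'} (D : set I) (X : I -> {RV P >-> E}) : Prop :=
  forall i j, D i -> D j -> forall A : set E, measurable A ->
  distribution P (X i) A = distribution P (X j) A.

Definition symmetric_rv {B : normedModType R} (V : {RV P >-> borel B}) : Prop :=
  forall A : set (borel B), measurable A ->
  pushforward P V A = pushforward P (fun w => (- (V w : B)) : borel B) A.

(* Sequences start at index 1; the term of index 0 is irrelevant. *)
Definition pos_index : set nat := [set n | (1 <= n)%N].

Definition rademacher_sequence (r : nat -> {RV P >-> R}) : Prop :=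
  [/\ independent_family pos_index r,
      identically_distributed pos_index r &
      forall n, pos_index n ->
        P [set w | r n w = 1] = (2^-1)%:E /\
        P [set w | r n w = -1] = (2^-1)%:E].

End random_variables.

(* Main.v *)
Require Import Defs.
From HB Require Import structures.
From mathcomp Require Import all_boot all_order all_algebra finmap.
From mathcomp Require Import all_classical all_reals all_analysis.
From mathcomp Require Import ring lra measurable_realfun.

Set Implicit Arguments.
Unset Strict Implicit.
Unset Printing Implicit Defensive.

Import Order.TTheory GRing.Theory Num.Theory.
Import numFieldNormedType.Exports.

Local Open Scope classical_set_scope.
Local Open Scope ring_scope.

(* By independence and symmetry, flipping the signs of the [V_i] does not change
   their joint law, so both probabilities are averages over all sign vectors,
   and it suffices to compare, pointwise in [w], the number of sign vectors for
   which each sum is large.  This is the contraction principle for Rademacher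
   sums with factor 2.  It applies because the monotonicity of [psi / phi] makes
   [(a_n / b_n) v], for [`|v| <= b_n], a multiple of [rescale phi psi v] by a
   factor in [[0, 1]], and because the remaining values are covered by the events
   [`|V_i| > b_n].  In part (i) the symmetric variables are the [R_i] themselves. *)

(** * Counting sign vectors: contraction for finite signed sums *)

Section sign_sums.
Context {R : realType} {B : normedModType R} {I : finType}.
Implicit Types (e : {ffun I -> bool}) (y z : I -> B) (s : seq I) (w : B).

Definition flip_sign (i : I) e : {ffun I -> bool} := [ffun j => (j == i) (+) e j].

Lemma flip_signK i : involutive (flip_sign i).
Proof. by move=> e; apply/ffunP => j; rewrite !ffunE addbA addbb addFb. Qed.

Lemma flip_sign_neq i e j : j != i -> flip_sign i e j = e j.
Proof. by rewrite ffunE => /negPf ->. Qed.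

Definition sign_sum y s e : B := \sum_(j <- s) (-1) ^+ e j *: y j.

Lemma sign_sum_cons y i s e :
  sign_sum y (i :: s) e = (-1) ^+ e i *: y i + sign_sum y s e.
Proof. by rewrite /sign_sum big_cons. Qed.

Lemma sign_sum_flip y i s e : i \notin s ->
  sign_sum y s (flip_sign i e) = sign_sum y s e.
Proof.
move=> is_; apply: eq_big_seq => j js; rewrite flip_sign_neq//.
by apply: contraNneq is_ => <-.
Qed.

(** Flipping coordinate [i] permutes the sign vectors and is invisible to [F b]. Adding the sum to
    its reindexed copy therefore produces both values of the sign at every [e]. *)
Lemma sum_signs_split i (F : bool -> {ffun I -> bool} -> nat) :
  (forall b e, F b (flip_sign i e) = F b e) ->
  (2 * \sum_(e : {ffun I -> bool}) F (e i) e =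
   \sum_e F false e + \sum_e F true e)%N.
Proof.
move=> Fi; rewrite mul2n -addnn {2}(reindex_inj (inv_inj (flip_signK i)))/=.
rewrite -!big_split/=; apply: eq_bigr => e _.
by rewrite Fi ffunE eqxx; case: (e i) => //=; rewrite addnC.
Qed.

(** The offset [w] is the part of the sum whose signs are already fixed. The count runs over signs
    on all of [I], even when [s] is only a part of it, so that counts for different [s] share one
    normalisation. *)
Definition exceedances c w y s : nat :=
  \sum_e (c < `|w + sign_sum y s e|)%R.

(** This conditions on the sign of [i]; the factor 2 appears because both counts on the right still
    range over all sign vectors. *)
Lemma exceedances_cons c w y i s : i \notin s ->
  (2 * exceedances c w y (i :: s) =
   exceedances c (w + y i)%R y s + exceedances c (w - y i)%R y s)%N.
Proof.
move=> is_; rewrite /exceedances.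
under eq_bigr do rewrite sign_sum_cons addrA.
rewrite (sum_signs_split (i := i)
  (F := fun b e => c < `|w + (-1) ^+ b *: y i + sign_sum y s e|)).
  by congr (_ + _)%N; apply: eq_bigr => e _;
    rewrite ?expr0 ?expr1 ?scale1r ?scaleN1r.
by move=> b e; rewrite sign_sum_flip.
Qed.

Definition neg_signs e : {ffun I -> bool} := [ffun j => ~~ e j].

Lemma neg_signsK : involutive neg_signs.
Proof. by move=> e; apply/ffunP => j; rewrite !ffunE negbK. Qed.

Lemma sign_sum_neg y s e : sign_sum y s (neg_signs e) = - sign_sum y s e.
Proof.
rewrite /sign_sum -sumrN; apply: eq_bigr => j _.
by rewrite ffunE -scaleNr; case: (e j); rewrite ?expr0 ?expr1 ?opprK.
Qed.

(* Reflection: [w + S] and [w - S] cannot both lie in the ball of radius [c]. *)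
Lemma exceedances_ge c w y s : c < `|w| ->
  (#|{ffun I -> bool}| <= 2 * exceedances c w y s)%N.
Proof.
move=> cw; rewrite mul2n -addnn /exceedances {2}(reindex_inj (inv_inj neg_signsK))/=.
rewrite -big_split/= -sum1_card; apply: leq_sum => e _; rewrite sign_sum_neg.
set S := sign_sum y s e.
case: (ltP c `|w + S|) => //= h1; case: (ltP c `|w - S|) => //= h2.
have : `|w *+ 2| <= c + c.
  rewrite (_ : w *+ 2 = (w + S) + (w - S)); last by rewrite addrACA subrr addr0.
  exact: le_trans (ler_normD _ _) (lerD h1 h2).
by rewrite normrMn mulr2n leNgt ltrD.
Qed.

(* Abel summation and Levy's inequality in one induction: since [g] is
   nonincreasing along [s], [M w + sum g_i e_i y_i] is a convex combination of
   multiples of partial sums, and a partial sum [w] outside of the ball of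
   radius [c] already forces half of the full sums out of it. *)
Lemma exceedances_contraction (c M : R) w y (g : I -> R) s :
  0 <= c -> 0 <= M -> uniq s -> (forall i, 0 <= g i) ->
  path (fun a b => b <= a) M [seq g i | i <- s] ->
  (exceedances (M * c)%R (M *: w) (fun i => g i *: y i) s <=
   2 * exceedances c w y s)%N.
Proof.
move=> c0 M0 us g0; elim: s M M0 w us => [|i s IH] M M0 w.
all: case: (ltP c `|w|) => [cw _ _|wc].
- apply: leq_trans (exceedances_ge _ _ cw).
  by rewrite -sum1_card leq_sum// => e _; rewrite leq_b1.
- move=> _ _; apply: leq_trans (leq0n _); rewrite leqn0; apply/eqP.
  apply: big1 => e _; rewrite /sign_sum big_nil addr0 normrZ ger0_norm//.
  by rewrite ltNge ler_wpM2l.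
- apply: leq_trans (exceedances_ge _ _ cw).
  by rewrite -sum1_card leq_sum// => e _; rewrite leq_b1.
move=> /= /andP[is_ us] /andP[giM ps].
rewrite -(leq_pmul2l (isT : 0 < 2)%N) !exceedances_cons// mulnDr.
(* The induction hypothesis is used at level [g i] with offset [w + y i] or [w - y i]. Splitting off
   [(M - g i) *: w], of norm at most [(M - g i) * c], shows that a sum beyond [M * c] leaves a
   remainder beyond [g i * c]. *)
apply: leq_add; apply: leq_trans (IH (g i) (g0 i) _ us ps).
all: apply: leq_sum => e _; case: ltP => //= h; rewrite lt0b ltNge.
all: apply/negP => k; move: h; apply/negP; rewrite -leNgt.
all: rewrite ?scalerDr ?scalerN in k.
all: rewrite -(subrK (g i *: w) (M *: w)) -scalerBl -!addrA.
all: rewrite [leRHS](_ : _ = (M - g i) * c + g i * c); last by rewrite -mulrDl subrK.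
all: apply: (le_trans (ler_normD _ _)); apply: lerD; last by rewrite -!addrA in k.
all: by rewrite normrZ ger0_norm ?subr_ge0// ler_wpM2l// subr_ge0.
Qed.

(** Sorting the indices by decreasing [g] gives the monotone path required by the induction, which
    starts from offset 0 and from [M = 1], the common bound on [g]. *)
Lemma contraction_principle (c : R) y (g : I -> R) :
  0 <= c -> (forall i, 0 <= g i <= 1) ->
  (\sum_(e : {ffun I -> bool}) (c < `|\sum_i (-1) ^+ e i *: (g i *: y i)|)%R <=
   2 * \sum_(e : {ffun I -> bool}) (c < `|\sum_i (-1) ^+ e i *: y i|)%R)%N.
Proof.
move=> c0 g01; pose s := sort (fun i j => g j <= g i) (enum I).
have sI : perm_eq (index_enum I) s by rewrite perm_sym perm_sort enumT.
have us : uniq s by rewrite sort_uniq enum_uniq.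
have ps : path (fun a b => b <= a) 1 [seq g i | i <- s].
  have : sorted (fun a b => b <= a) [seq g i | i <- s].
    by rewrite sorted_map; apply: sort_sorted => a b; exact: le_total.
  have := g01; case: s {sI us} => //= i s /(_ i) /andP[_ ->].
  by move=> ->.
have g0 i : 0 <= g i by case/andP: (g01 i).
have := exceedances_contraction 0 y c0 ler01 us g0 ps.
rewrite scaler0 mul1r /exceedances.
by under eq_bigr do rewrite add0r /sign_sum -(perm_big _ sI);
   under [in leqRHS]eq_bigr do rewrite add0r /sign_sum -(perm_big _ sI).
Qed.
End sign_sums.

(** * Borel measurability of sums and norms in a separable normed space *)

Lemma countable_bigcup_measurable {d : measure_display} {T : measurableType d}
    {J : pointedType} (D : set J) (F : J -> set T) :
  countable D -> (forall q, D q -> measurable (F q)) ->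
  measurable (\bigcup_(q in D) F q).
Proof.
move=> cD mF; have [->|[f]] := pfcard_geP cD; first by rewrite bigcup_set0.
rewrite -(image_eq f) bigcup_image.
by apply: bigcup_measurable => k _; apply: mF; exact: funS.
Qed.

Lemma continuous_measurable_borel {R : realType} {B C : normedModType R}
    (f : B -> C) : continuous f ->
  measurable_fun setT (f : borel B -> borel C).
Proof.
move=> cf; apply: (@measurability _ _ (borel B) (borel C) setT f (@open C)) => //.
move=> _ [U oU <-]; rewrite setTI; apply: sub_sigma_algebra.
by apply: open_comp => // x _; exact: cf.
Qed.

Section separable_space.
Context {R : realType} {B : normedModType R}.
Hypothesis B_separable : separable B.
Context {d : measure_display} {T : measurableType d}.
Implicit Types (X Y : T -> borel B).

Lemma open_measurable_borel (U : set B) :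
  open U -> measurable (U : set (borel B)).
Proof. by move=> oU; apply: sub_sigma_algebra. Qed.

Lemma measurable_fun_borel X :
  (forall U : set B, open U -> measurable (X @^-1` U)) ->
  measurable_fun setT X.
Proof.
move=> h; apply: (@measurability _ _ _ _ setT X (@open B)) => //.
by move=> _ [U oU <-]; rewrite setTI; exact: h.
Qed.

(* An open set containing [X w + Y w] contains the sum of two balls of the same
   radius [n.+1^-1] centred in the countable dense set. *)
Lemma measurable_fun_add X Y : measurable_fun setT X -> measurable_fun setT Y ->
  measurable_fun setT (fun w => (X w : B) + (Y w : B) : borel B).
Proof.
move=> mX mY; apply: measurable_fun_borel => U oU.
have [S [cS dS]] := B_separable.
have mball (Z : T -> borel B) p (r : R) : measurable_fun setT Z ->
    measurable (Z @^-1` (ball p r : set B)).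
  move=> mZ; rewrite -[X in measurable X]setTI; apply: mZ => //.
  by apply: open_measurable_borel; exact: ball_open.
pose G (q : B * B * nat) : set T :=
  (X @^-1` (ball q.1.1 (q.2.+1%:R^-1 : R) : set B)) `&`
  (Y @^-1` (ball q.1.2 (q.2.+1%:R^-1 : R) : set B)).
pose D := [set q : B * B * nat | [/\ S q.1.1, S q.1.2 &
  forall u v : B, ball q.1.1 (q.2.+1%:R^-1 : R) u ->
     ball q.1.2 (q.2.+1%:R^-1 : R) v -> U (u + v)]].
rewrite (_ : _ @^-1` U = \bigcup_(q in D) G q); last first.
  apply/seteqP; split=> [w Uw|w [[[p q] n] /= [_ _ DU] [/= Xw Yw]]]; last exact: DU.
  have [e e0 eU] : exists2 e : R, 0 < e & ball ((X w : B) + (Y w : B)) e `<=` U.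
    by apply/nbhs_ballP; apply: open_nbhs_nbhs; split.
  (* Four distances add up, from [X w] to [p] to [u] and from [Y w] to [q] to [v], each below the
     radius; hence [e / 4]. *)
  have [n ne] : exists n, n.+1%:R^-1 < e / 4.
    have e4 : 0 < e / 4 by rewrite divr_gt0.
    by have [n _ /(_ n (leqnn n))] := near_infty_natSinv_lt (PosNum e4); exists n.
  set r : R := n.+1%:R^-1 in ne *.
  have r0 : 0 < r by rewrite invr_gt0.
  have near_S (z : B) : exists2 p, S p & ball p r z.
    have [|p [zp Sp]] := dS (ball z r) _ (ball_open z r).
      by exists z; exact: ballxx.
    by exists p => //; exact: ball_sym.
  have [p Sp pX] := near_S (X w); have [q Sq qY] := near_S (Y w).
  exists (p, q, n) => //; split=> // u v; rewrite -/r => pu qv; apply: eU.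
  move: pX qY pu qv; rewrite -!ball_normE /ball_/= => pX qY pu qv.
  have Xu := ler_distD p (X w : B) u; have Yv := ler_distD q (Y w : B) v.
  rewrite (distrC _ p) in Xu; rewrite (distrC _ q) in Yv.
  rewrite opprD addrACA; apply: le_lt_trans (ler_normD _ _) _.
  by lra.
apply: countable_bigcup_measurable.
  apply: (@sub_countable _ _ _ (S `*` S `*` setT)).
    by apply: subset_card_le => -[[p q] n] [].
  by apply: countableX; [exact: countableX|exact: countableP].
by move=> q _; apply: measurableI; exact: mball.
Qed.

Lemma measurable_fun_sum (I : eqType) (s : seq I) (X : I -> T -> borel B) :
  (forall i, i \in s -> measurable_fun setT (X i)) ->
  measurable_fun setT (fun w => (\sum_(i <- s) (X i w : B)) : borel B).
Proof.
elim: s => [|i s IH] mX.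
  by under eq_fun do rewrite big_nil; exact: measurable_cst.
under eq_fun do rewrite big_cons; apply: measurable_fun_add.
  by apply: mX; rewrite mem_head.
by apply: IH => j js; apply: mX; rewrite inE js orbT.
Qed.

Lemma measurable_norm_gt (c : R) X : measurable_fun setT X ->
  measurable [set w | c < `|X w : B|].
Proof.
move=> mX; rewrite -[X in measurable X]setTI.
apply: (mX measurableT [set z : B | c < `|z|]); apply: open_measurable_borel.
apply: (open_comp (f := fun z : B => `|z|) (D := [set u | c < u])).
  by move=> z _; exact: norm_continuous.
exact: open_gt.
Qed.
End separable_space.

(** * Joint law of a finite family *)

Section joint_law.
Context {d d' : measure_display} {E : measurableType d'} {J : finType}.

(** These are the measurable boxes, a pi-system generating the product sigma-algebra on [J -> E]. *)
Definition cylinders : set (set (J -> E)) :=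
  [set C | exists2 A : J -> set E, (forall j, measurable (A j)) &
    C = [set v | forall j, A j (v j)]].

Definition pathType := g_sigma_algebraType cylinders.

Lemma cylinders_setI : setI_closed cylinders.
Proof.
move=> _ _ [A mA ->] [A' mA' ->]; exists (fun j => A j `&` A' j).
  by move=> j; exact: measurableI.
by apply/seteqP; split=> v /=; [case=> h h' j; split|
  move=> h; split=> j; have [] := h j].
Qed.

Lemma cylinders_setT : cylinders setT.
Proof. by exists (fun=> setT) => //; apply/seteqP; split. Qed.

Lemma measurable_coord (j : J) :
  measurable_fun setT (fun v : pathType => v j).
Proof.
move=> _ A mA; rewrite setTI; apply: sub_sigma_algebra.
exists (fun i => if i == j then A else setT); first by move=> i; case: ifP.
apply/seteqP; split=> v /= h; last by have := h j; rewrite eqxx.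
by move=> i; case: eqP => // ->.
Qed.

Context {T : measurableType d}.

Lemma measurable_path (X : J -> T -> E) :
  (forall j, measurable_fun setT (X j)) ->
  measurable_fun setT (fun w => (fun j => X j w) : pathType).
Proof.
move=> mX; apply: (@measurability _ _ T pathType _ _ cylinders) => //.
move=> _ [_ [A mA ->] <-]; rewrite setTI.
rewrite (_ : _ @^-1` _ =
  \bigcap_(j in [set` finset.setT]) X j @^-1` A j); last first.
  apply/seteqP; split=> w /= h j; first by move=> _; exact: h.
  by apply: h; rewrite /= finset.inE.
apply: fin_bigcap_measurable.
- exact: finite_finset.
- by move=> j _; rewrite -[X in measurable X]setTI; exact: mX.
Qed.

Context {R : realType} (P : probability T R).

(** Both joint laws are finite measures that agree on a generating pi-system, so uniqueness of
    measures applies, with the constant sequence [setT] as exhaustion. *)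
Lemma eq_joint_law (X Y : J -> T -> E) :
  (forall j, measurable_fun setT (X j)) -> (forall j, measurable_fun setT (Y j)) ->
  (forall A : J -> set E, (forall j, measurable (A j)) ->
     P [set w | forall j, A j (X j w)] = P [set w | forall j, A j (Y j w)]) ->
  forall U : set pathType, measurable U ->
  P [set w | U (fun j => X j w)] = P [set w | U (fun j => Y j w)].
Proof.
move=> mX mY XY U mU.
pose X' : {RV P >-> pathType} := HB.pack (fun w => (fun j => X j w) : pathType)
  (isMeasurableFun.Build _ _ T pathType _ (measurable_path mX)).
pose Y' : {RV P >-> pathType} := HB.pack (fun w => (fun j => Y j w) : pathType)
  (isMeasurableFun.Build _ _ T pathType _ (measurable_path mY)).
change (distribution P X' U = distribution P Y' U).
have cover : \bigcup_(k : nat) [set: pathType] = setT.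
  by apply: bigcup_const; exists 0%N.
apply: (@measure_unique _ R pathType cylinders (fun=> setT)
  erefl cylinders_setI (fun=> cylinders_setT) cover) => //.
- by move=> _ [A mA ->]; exact: XY.
- move=> _; rewrite /= /distribution /pushforward preimage_setT.
  by rewrite probability_setT ltry.
Qed.
End joint_law.

(** * From counts of sign vectors to probabilities *)

(** A sum of measures is the integral of the number of sets containing [w], so a pointwise
    comparison of counts can be integrated. *)
Lemma le_sum_measure_count {d : measure_display} {T : measurableType d}
    {R : realType} (mu : {measure set T -> \bar R}) {I : finType} (k : nat)
    (E F : I -> set T) :
  (forall i, measurable (E i)) -> (forall i, measurable (F i)) ->
  (forall w, \sum_i (w \in E i) <= k * \sum_i (w \in F i))%N ->
  (\sum_i mu (E i) <= k%:R%:E * \sum_i mu (F i))%E.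
Proof.
move=> mE mF EF.
have sumE (G : I -> set T) : (forall i, measurable (G i)) ->
    (\sum_i mu (G i) = \int[mu]_w (\sum_i (w \in G i))%N%:R%:E)%E.
  move=> mG; transitivity (\int[mu]_w (\sum_i (\1_(G i) w)%:E))%E.
    rewrite ge0_integral_sum//.
    - by apply: eq_bigr => i _; rewrite integral_indic// setIT.
    - by move=> i; apply/measurable_EFinP; exact: measurable_indic.
  by apply: eq_integral => w _; rewrite sumEFin natr_sum.
have mN (G : I -> set T) : (forall i, measurable (G i)) ->
    measurable_fun setT (fun w => (\sum_i (w \in G i))%N%:R%:E : \bar R).
  move=> mG; apply/measurable_EFinP; under eq_fun do rewrite natr_sum.
  by apply: measurable_sum => i; exact: measurable_indic.
rewrite !sumE// -ge0_integralZl//; last exact: mN.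
apply: ge0_le_integral => //.
- exact: mN.
- by apply/emeasurable_funM => //; exact: mN.
- by move=> w _; rewrite -EFinM -natrM lee_fin ler_nat.
Qed.

(* [sigma] plays the role of [v |-> - v] on the values of the variables [X j]. *)
Section symmetric_sums.
Context {R : realType} {B : normedModType R}.
Hypothesis B_separable : separable B.
Context {d d' : measure_display} {T : measurableType d} (P : probability T R).
Context {E : measurableType d'} (sigma : E -> E).
Hypothesis measurable_sigma : measurable_fun setT sigma.
Context {J : finType} (X : J -> {RV P >-> E}).
Hypothesis X_indep : forall A : J -> set E, (forall j, measurable (A j)) ->
  P [set w | forall j, A j (X j w)] = (\prod_j P (X j @^-1` A j))%E.
Hypothesis X_sym : forall j (A : set E), measurable A ->
  P (X j @^-1` A) = P [set w | A (sigma (X j w))].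

Let signed (b : bool) (v : E) : E := if b then sigma v else v.

Let measurable_signed b : measurable_fun setT (signed b).
Proof. by case: b; [exact: measurable_sigma|exact: measurable_id]. Qed.

(** It suffices to treat boxes: independence factors the probability, and symmetry makes each factor
    indifferent to its sign. *)
Lemma signed_joint_law (e : J -> bool) (U : set (@pathType _ E J)) :
  measurable U ->
  P [set w | U (fun j => X j w)] = P [set w | U (fun j => signed (e j) (X j w))].
Proof.
move=> mU; apply: eq_joint_law mU => [j|j|A mA].
- exact: measurable_funPT.
- apply: (measurableT_comp (measurable_signed (e j))); exact: measurable_funPT.
pose A' j : set E := signed (e j) @^-1` A j.
have mA' j : measurable (A' j).
  by rewrite -[X in measurable X]setTI; exact: measurable_signed.
rewrite X_indep// (X_indep mA'); apply: eq_bigr => j _.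
by rewrite /A' /signed; case: (e j) => //; exact: X_sym.
Qed.

Let odd_measurable (h : J -> E -> B) :=
  forall j, measurable_fun setT (h j : E -> borel B) /\
    forall v, h j (sigma v) = - h j v.

Lemma signed_sum_law (h : J -> E -> B) (c : R) (e : J -> bool) :
  odd_measurable h ->
  P [set w | c < `|\sum_j h j (X j w)|] =
  P [set w | c < `|\sum_j (-1) ^+ e j *: h j (X j w)|].
Proof.
move=> mh; pose U : set (@pathType _ E J) := [set v | c < `|\sum_j h j (v j)|].
have mU : measurable U.
  apply: measurable_norm_gt; apply: measurable_fun_sum => // j _.
  exact: measurableT_comp (mh j).1 (measurable_coord j).
rewrite [LHS](signed_joint_law e mU); congr (P _).
apply/seteqP; split=> w /=; congr (_ < `|_|); apply: eq_bigr => j _.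
all: rewrite /signed; case: (e j); rewrite ?expr0 ?expr1 ?scale1r ?scaleN1r//.
all: by rewrite (mh j).2.
Qed.

Lemma symmetric_contraction (f g : J -> E -> B) (c : R) : 0 <= c ->
  odd_measurable f -> odd_measurable g ->
  (forall j v, exists2 k : R, 0 <= k <= 1 & f j v = k *: g j v) ->
  (P [set w | (c < `|\sum_j f j (X j w)|)%R] <=
   2%:E * P [set w | (c < `|\sum_j g j (X j w)|)%R])%E.
Proof.
move=> c0 mf mg fg.
pose ev (h : J -> E -> B) (e : {ffun J -> bool}) : set T :=
  [set w | c < `|\sum_j (-1) ^+ e j *: h j (X j w)|].
have mev h e : odd_measurable h -> measurable (ev h e).
  move=> mh; apply: measurable_norm_gt; apply: measurable_fun_sum => // j _.
  apply: (@measurableT_comp _ _ _ _ _ _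
    (fun v : borel B => (-1) ^+ e j *: (v : B) : borel B)).
    by apply: continuous_measurable_borel; exact: scaler_continuous.
  by apply: measurableT_comp (mh j).1 _; exact: measurable_funPT.
(* By [signed_sum_law], the probability of [ev h e] is the same for all [e]. *)
have sum_ev h : odd_measurable h ->
    (\sum_e P (ev h e) = #|{ffun J -> bool}|%:R%:E *
      P [set w | (c < `|\sum_j h j (X j w)|)%R])%E.
  move=> mh; under eq_bigr do rewrite -signed_sum_law//.
  have /fineK <- : P [set w | (c < `|\sum_j h j (X j w)|)%R] \is a fin_num.
    apply: fin_num_measure; apply: measurable_norm_gt.
    apply: measurable_fun_sum => // j _.
    by apply: measurableT_comp (mh j).1 _; exact: measurable_funPT.
  by rewrite sumEFin sumr_const -EFinM mulr_natl.
have : (\sum_e P (ev f e) <= 2%:R%:E * \sum_e P (ev g e))%E.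
  apply: le_sum_measure_count => [e|e|w]; [exact: mev|exact: mev|].
  (* With [w] fixed, the factors [k j] are constants independent of the signs, as the contraction
     principle requires. *)
  have /choice[k kP] : forall j, exists k : R,
      0 <= k <= 1 /\ f j (X j w) = k *: g j (X j w).
    by move=> j; have [k ? ?] := fg j (X j w); exists k.
  have k01 j : 0 <= k j <= 1 by case: (kP j).
  have fk j : f j (X j w) = k j *: g j (X j w) by case: (kP j).
  have := contraction_principle (fun j => g j (X j w)) c0 k01.
  have evE (h : J -> E -> B) e :
      (w \in ev h e) = (c < `|\sum_j (-1) ^+ e j *: h j (X j w)|).
    by apply/idP/idP; rewrite inE.
  rewrite (eq_bigr (fun e => (w \in ev f e) : nat)); last first.
    by move=> e _; rewrite evE; under [in RHS]eq_bigr do rewrite fk.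
  rewrite [X in (_ <= 2 * X)%N](eq_bigr (fun e => (w \in ev g e) : nat))//.
  by move=> e _; rewrite evE.
rewrite !sum_ev// muleCA lee_pmul2l//.
by rewrite lte_fin ltr0n; apply/card_gt0P; exists [ffun=> true].
Qed.
End symmetric_sums.

(** * The inverse of [psi] and the rescaling map *)

Section rescaling.
Context {R : realType} (phi psi : R -> R).
Hypotheses (phi_nonneg : maps_nonneg phi) (psi_nonneg : maps_nonneg psi)
  (phi_cont : continuous_nonneg phi) (psi_cont : continuous_nonneg psi)
  (phi_incr : increasing_nonneg phi) (psi_incr : increasing_nonneg psi)
  (phi0 : phi 0 = 0) (psi0 : psi 0 = 0)
  (phi_infty : phi t @[t --> +oo] --> +oo)
  (quot_nondecr : nondecreasing_nonneg (quotient_ext psi phi)).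

Lemma increasing_nonneg_lt (f : R -> R) s t :
  increasing_nonneg f -> 0 <= s -> s < t -> f s < f t.
Proof.
move=> fi s0 st; apply: fi => //; rewrite in_itv/= andbT//.
exact: le_trans s0 (ltW st).
Qed.

Lemma increasing_nonneg_lt_mono (f : R -> R) s t :
  increasing_nonneg f -> 0 <= s -> 0 <= t -> (f s < f t) = (s < t).
Proof.
move=> fi s0 t0; apply/idP/idP; last exact: increasing_nonneg_lt.
case: (ltgtP s t) => // [ts|->]; last by rewrite ltxx.
by move=> /(lt_trans (increasing_nonneg_lt fi t0 ts)); rewrite ltxx.
Qed.

Lemma quotient_le s t : 0 < s -> s <= t -> psi s / phi s <= psi t / phi t.
Proof.
move=> s0 st; have t0 := lt_le_trans s0 st.
have := quot_nondecr (x := s) (y := t).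
by rewrite !in_itv/= !andbT (ltW s0) (ltW t0) /quotient_ext !gt_eqF//; exact.
Qed.

(** Monotonicity of the quotient gives [psi >= (psi 1 / phi 1) * phi] beyond 1, so [psi] inherits
    unboundedness from [phi]; the intermediate value theorem does the rest. *)
Lemma psi_surj s : 0 <= s -> exists2 u, 0 <= u & psi u = s.
Proof.
move=> s0.
have phi1 : 0 < phi 1 by rewrite -phi0; exact: increasing_nonneg_lt.
have psi1 : 0 < psi 1 by rewrite -psi0; exact: increasing_nonneg_lt.
have [M M1 sM] : exists2 M, 1 <= M & s <= psi M.
  have /cvgryPge/(_ (s / (psi 1 / phi 1)))[A [Ar HA]] := phi_infty.
  (* The eventual bound on [phi] holds strictly beyond [A], and the quotient comparison starts at
     1. *)
  pose M := Num.max 1 (A + 1).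
  have M1 : 1 <= M by rewrite le_max lexx.
  exists M => //.
  have phiM : 0 < phi M.
    by rewrite -phi0; apply: increasing_nonneg_lt => //; exact: lt_le_trans M1.
  have := quotient_le ltr01 M1; rewrite ler_pdivlMr//; apply: le_trans.
  rewrite -ler_pdivrMl ?divr_gt0// mulrC; apply: HA.
  by rewrite lt_max ltrDl ltr01 orbT.
have M0 : 0 <= M := le_trans ler01 M1.
have [] := @IVT R psi 0 M s M0.
- apply: continuous_subspaceW psi_cont => x /=.
  by rewrite !in_itv/= => /andP[-> _].
- by rewrite psi0 ge_min s0 le_max sM orbT.
- by move=> u; rewrite in_itv/= => /andP[u0 _] <-; exists u.
Qed.

Lemma psiK u : 0 <= u -> inv_nonneg psi (psi u) = u.
Proof.
move=> u0; rewrite /inv_nonneg pinvKV// ?inE/= ?in_itv/= ?u0//.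
move=> x y; rewrite !inE/= !in_itv/= !andbT => x0 y0 xy.
apply/eqP; case: ltgtP => //.
all: by rewrite -(increasing_nonneg_lt_mono psi_incr)// xy ltxx.
Qed.

Context {B : normedModType R}.
Implicit Types v : B.

Lemma rescale0 : rescale phi psi (0 : B) = 0.
Proof. by rewrite /rescale !scaler0. Qed.

Lemma rescaleN v : rescale phi psi (- v) = - rescale phi psi v.
Proof. by rewrite /rescale normrN !scalerN. Qed.

(** Write [|v|] as [psi u], so that [u <= N]. The factor is the quotient [psi / phi] at [u] divided
    by its value at [N], hence at most 1 by monotonicity. *)
Lemma scale_eq_rescale (N : R) v : 0 < N -> `|v| <= psi N ->
  exists2 k, 0 <= k <= 1 & (phi N / psi N) *: v = k *: rescale phi psi v.
Proof.
move=> N0 vN; have [->|v0] := eqVneq v 0.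
  by exists 0; rewrite ?lexx ?ler01// scaler0 scale0r.
have vp : 0 < `|v| by rewrite normr_gt0.
have [u u0 uv] := psi_surj (normr_ge0 v).
have up : 0 < u by rewrite -(increasing_nonneg_lt_mono psi_incr)// psi0 uv.
have pos f w : increasing_nonneg f -> f 0 = 0 -> 0 < w -> 0 < f w :> R.
  by move=> fi f0 w0; rewrite -f0; exact: increasing_nonneg_lt.
have phiN := pos _ _ phi_incr phi0 N0; have psiN := pos _ _ psi_incr psi0 N0.
have phiu := pos _ _ phi_incr phi0 up; have psiu := pos _ _ psi_incr psi0 up.
have uN : u <= N.
  by rewrite leNgt -(increasing_nonneg_lt_mono psi_incr) ?ltW// -leNgt uv.
exists ((phi N / psi N) * (psi u / phi u)).
  have q0 : 0 < phi N / psi N by exact: divr_gt0.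
  apply/andP; split; first by rewrite mulr_ge0 ?divr_ge0 ?ltW.
  by rewrite -ler_pdivlMl// mulr1 invf_div; exact: quotient_le.
rewrite /rescale -uv psiK// !scalerA; congr (_ *: _).
by rewrite uv; field; rewrite !gt_eqF.
Qed.

Lemma norm_rescale_le v : `|rescale phi psi v| <= phi (inv_nonneg psi `|v|).
Proof.
have [->|v0] := eqVneq v 0.
  by rewrite rescale0 !normr0 -{2}psi0 psiK// phi0.
have [u u0 uv] := psi_surj (normr_ge0 v).
rewrite /rescale normrZ normrZ normfV normr_id mulVf ?normr_eq0// mulr1 ger0_norm//.
by rewrite -uv psiK//; exact: phi_nonneg.
Qed.

(** By monotonicity and surjectivity, the inverse maps the interval between [psi m] and
    [psi (u + e)] to within [e] of [u]. The maximum in [m] keeps the left end in the domain of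
    [psi]. *)
Lemma inv_psi_continuous s : 0 < s -> {for s, continuous (inv_nonneg psi)}.
Proof.
move=> s0; have [u u0 us] := psi_surj (ltW s0).
have up : 0 < u by rewrite -(increasing_nonneg_lt_mono psi_incr)// psi0 us.
apply/cvgrPdist_lt => e e0; rewrite -us psiK//.
pose m := Num.max 0 (u - e).
have m0 : 0 <= m by rewrite le_max lexx.
have mu : m < u by rewrite gt_max up ltrBlDr ltrDl.
have ue : 0 <= u + e by rewrite addr_ge0// ltW.
near=> x.
have x1 : psi m < x.
  by near: x; apply: lt_nbhsr; apply: increasing_nonneg_lt.
have x2 : x < psi (u + e).
  by near: x; apply: lt_nbhsl; apply: increasing_nonneg_lt; rewrite // ltrDl.
have x0 : 0 <= x by apply: ltW; exact: le_lt_trans (psi_nonneg m0) x1.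
have [z z0 zx] := psi_surj x0; move: x1 x2; rewrite -zx psiK//.
rewrite !(increasing_nonneg_lt_mono psi_incr)// gt_max => /andP[_ ez] ze.
by rewrite ltr_distlC; apply/andP; split; lra.
Unshelve. all: by end_near. Qed.

(** The direction of [x] has no limit at 0, so continuity there comes from the norm bound:
    [phi h < e] and [|x| < psi h] suffice. Elsewhere the map is built from continuous ones. *)
Lemma rescale_continuous : continuous (rescale phi psi : B -> B).
Proof.
move=> v; have [->|v0] := eqVneq v 0.
  apply/cvgrPdist_lt => e e0; rewrite rescale0.
  have [h h0 phih] : exists2 h, 0 < h & phi h < e.
    have [_] := (continuous_within_itvcyP 0 phi).1 phi_cont.
    rewrite phi0 => /cvgr_lt/(_ _ e0) phi_lt.
    have [h [h0 ?]] := filter_ex (filterI (nbhs_right_gt 0) phi_lt).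
    by exists h.
  have psih : 0 < psi h by rewrite -psi0; exact: increasing_nonneg_lt.
  near=> x; rewrite sub0r normrN; apply: le_lt_trans (norm_rescale_le _) _.
  apply: le_lt_trans phih.
  have xh : `|x| < psi h.
    by near: x; exact: nbhs0_lt.
  have [z z0 zx] := psi_surj (normr_ge0 x); move: xh; rewrite -zx psiK//.
  rewrite (increasing_nonneg_lt_mono psi_incr z0 (ltW h0)) => zh.
  by apply: ltW; exact: (increasing_nonneg_lt phi_incr z0 zh).
have vp : 0 < `|v| by rewrite normr_gt0.
have [u u0 us] := psi_surj (ltW vp).
have up : 0 < u by rewrite -(increasing_nonneg_lt_mono psi_incr)// psi0 us.
have rho_cont : {for `|v|, continuous (phi \o inv_nonneg psi)}.
  apply: continuous_comp; first exact: inv_psi_continuous.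
  rewrite -us psiK//; have [phic _] := (continuous_within_itvcyP 0 phi).1 phi_cont.
  by apply: phic; rewrite in_itv/= andbT.
have normc : `|x| @[x --> v] --> `|v| by exact: norm_continuous.
apply: cvgZ; first exact: cvg_comp normc rho_cont.
apply: cvgZ; last exact: cvg_id.
by apply: cvgV => //; rewrite gt_eqF.
Unshelve. all: by end_near. Qed.
End rescaling.

(** * Independence and symmetry for sequences indexed from 1 *)

Section positive_indices.
Context {R : realType} {d d' : measure_display} {T : measurableType d}.
Context {E : measurableType d'} (P : probability T R).

Lemma independent_family_ord (X : nat -> {RV P >-> E}) (n : nat) :
  independent_family pos_index X ->
  forall A : 'I_n -> set E, (forall j, measurable (A j)) ->
  P [set w | forall j : 'I_n, A j (X j.+1 w)] =
  (\prod_(j < n) P (X j.+1 @^-1` A j))%E.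
Proof.
move=> Xi A mA.
(* The shift sends [j : 'I_n] to the index [j.+1]. Since [0.-1 = 0], index 0 would repeat the first
   set, but [K] excludes it. *)
pose A' (i : nat) : set E := if insub i.-1 is Some j then A j else setT.
have A'E (j : 'I_n) : A' j.+1 = A j by rewrite /A'/= valK.
pose K : {fset nat} := [fset i in iota 1 n]%fset.
have KP i : (i \in K) = (0 < i <= n)%N by rewrite !inE mem_iota add1n ltnS.
have -> : [set w | forall j : 'I_n, A j (X j.+1 w)] =
    \bigcap_(i in [set` K]) (X i @^-1` A' i).
  apply/seteqP; split=> w /= h.
    move=> i; rewrite /= KP => /andP[i0 iN].
    have iltn : (i.-1 < n)%N by rewrite prednK.
    by have := h (Ordinal iltn); rewrite -A'E /= prednK.
  by move=> j; rewrite -A'E; apply: h; rewrite /= KP/= ltn_ord.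
rewrite Xi.
- rewrite (perm_big (iota 1 n)) /=.
    transitivity (\prod_(1 <= i < n.+1) P (X i @^-1` A' i))%E.
      by rewrite /index_iota subn1.
    by rewrite big_add1 big_mkord; apply: eq_bigr => j _; rewrite A'E.
  apply: uniq_perm; rewrite ?iota_uniq ?fset_uniq// => i.
  by rewrite KP mem_iota add1n ltnS.
- by move=> i /=; rewrite KP => /andP[].
- by move=> i _; rewrite /A'; case: insub.
Qed.

(** The two atoms carry total mass 1, so the law is determined by membership of [1] and [-1], which
    negation exchanges. *)
Lemma rademacher_symmetric (r : nat -> {RV P >-> R}) (i : nat) (A : set R) :
  rademacher_sequence r -> pos_index i -> measurable A ->
  P (r i @^-1` A) = P [set w | A (- r i w)].
Proof.
move=> [_ _ rP] /rP[P1 PN1] mA.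
have mr (C : set R) : measurable C -> measurable (r i @^-1` C).
  by move=> mC; rewrite -[X in measurable X]setTI; exact: measurable_funPT.
have law (C : set R) : measurable C -> P (r i @^-1` C) =
    ((if 1 \in C then 2^-1 else 0)%:E + (if -1 \in C then 2^-1 else 0)%:E)%E.
  move=> mC.
  pose S x := r i @^-1` [set x].
  have mS x : measurable (S x) by apply: mr.
  have PS x : P (S x `&` r i @^-1` C) = (if x \in C then P (S x) else 0%E).
    case: ifPn => [|/negP]; rewrite inE => xC.
      by congr (P _); apply: setIidl => w /= ->.
    rewrite (_ : _ `&` _ = set0) ?measure0//.
    by apply/seteqP; split=> w //= [-> /xC].
  have dS : S 1 `&` S (-1) = set0.
    apply/seteqP; split=> w //= [r1 rN1].
    by move/eqP: rN1; rewrite r1 -subr_eq0 opprK gt_eqF.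
  have PS1 : P (S 1) = (2^-1)%:E by exact: P1.
  have PSN1 : P (S (-1)) = (2^-1)%:E by exact: PN1.
  (* The complement of the two atoms is null, so intersecting with them loses no mass. *)
  have PD C' : measurable C' -> P (C' `&` (S 1 `|` S (-1))) = P C'.
    move=> mC'.
    have P0 : P (~` (S 1 `|` S (-1))) = 0%E.
      rewrite probability_setC; last exact: measurableU.
      rewrite (_ : P (S 1 `|` S (-1)) = (P (S 1)%R + P (S (-1)%R))%E); last first.
        exact: measureU.
      have half2 : 2^-1 + 2^-1 = 1 :> R by lra.
      by rewrite PS1 PSN1 -EFinD half2 subrr.
    have mSS : measurable (S 1 `|` S (-1)) by exact: measurableU.
    have P0' : P (C' `\` (S 1 `|` S (-1))) = 0%E.
      by apply: subset_measure0 P0 => //; [exact: measurableD|exact: measurableC].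
    transitivity (P (C' `\` (S 1%R `|` S (-1)%R)) +
      P (C' `&` (S 1%R `|` S (-1)%R)))%E.
      by rewrite P0' add0e.
    by apply/esym; exact: measureDI.
  rewrite -PD; last exact: mr.
  rewrite setIUr; transitivity (P (r i @^-1` C `&` S 1%R) +
    P (r i @^-1` C `&` S (-1)%R))%E.
    apply: measureU; last by rewrite setIACA dS setI0.
    - by apply: measurableI => //; exact: mr.
    - by apply: measurableI => //; exact: mr.
  rewrite ![_ @^-1` C `&` _]setIC !PS PS1 PSN1.
  by do 2 case: ifP.
have mN : measurable [set x : R | A (- x)].
  rewrite -[X in measurable X]setTI.
  exact: (@oppr_measurable R setT).
have inN (x : R) : (x \in [set x : R | A (- x)]) = (- x \in A).
  by apply/idP/idP; rewrite !inE.
transitivity (P (r i @^-1` [set x | A (- x)])) => //.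
by rewrite law// (law _ mN) addeC !inN opprK.
Qed.
End positive_indices.

(** * Contraction applied to Rademacher sums and to truncated symmetric variables *)

Theorem theorem1p1 (R : realType) (B : completeNormedModType R)
    (B_separable : separable B) (phi psi : R -> R)
    (phi_nonneg : maps_nonneg phi) (psi_nonneg : maps_nonneg psi)
    (phi_cont : continuous_nonneg phi) (psi_cont : continuous_nonneg psi)
    (phi_incr : increasing_nonneg phi) (psi_incr : increasing_nonneg psi)
    (phi0 : phi 0 = 0) (psi0 : psi 0 = 0)
    (phi_infty : phi t @[t --> +oo] --> +oo)
    (quot_nondecr : nondecreasing_nonneg (quotient_ext psi phi)) :
  let a (n : nat) : R := phi n%:R in
  let b (n : nat) : R := psi n%:R in
  (forall (x : nat -> B), (forall n, (1 <= n)%N -> `|x n| <= b n) ->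
   forall (d : measure_display) (T : measurableType d) (P : probability T R)
     (r : nat -> {RV P >-> R}), rademacher_sequence r ->
   forall (n : nat) (t : R), (1 <= n)%N -> 0 <= t ->
   (P [set w | (t * b n < `|\sum_(1 <= i < n.+1) r i w *: x i|)%R] <=
    2%:E * P [set w | (t * a n <
      `|\sum_(1 <= i < n.+1) r i w *: rescale phi psi (x i)|)%R])%E) /\
  (forall (d : measure_display) (T : measurableType d) (P : probability T R)
     (V : nat -> {RV P >-> borel B}),
   independent_family pos_index V ->
   (forall n, (1 <= n)%N -> symmetric_rv (V n)) ->
   forall (n : nat) (t : R), (1 <= n)%N -> 0 <= t ->
   (P [set w | (t * b n < `|\sum_(1 <= i < n.+1) (V i w : B)|)%R] <=
    4%:E * P [set w | (t * a n <
      `|\sum_(1 <= i < n.+1) rescale phi psi (V i w : B)|)%R] +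
    \sum_(1 <= i < n.+1) P [set w | (b n < `|V i w : B|)%R])%E).
Proof.
move=> a b.
have a0 n : (1 <= n)%N -> 0 < a n.
  by move=> n1; rewrite -phi0; apply: increasing_nonneg_lt; rewrite ?ltr0n.
have b0 n : (1 <= n)%N -> 0 < b n.
  by move=> n1; rewrite -psi0; apply: increasing_nonneg_lt; rewrite ?ltr0n.
(* Scaling by [a n / b n] brings both events to the common threshold [t * a n], as contraction
   requires. *)
have gt_rescale n (t : R) (v : B) : (1 <= n)%N ->
    (t * b n < `|v|) = (t * a n < `|(a n / b n) *: v|).
  move=> n1; have an := a0 n n1; have bn := b0 n n1.
  rewrite normrZ ger0_norm ?divr_ge0 ?ltW// mulrAC ltr_pdivlMr//.
  by rewrite mulrAC [a n * _]mulrC ltr_pM2r.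
have ta_ge0 n (t : R) : (1 <= n)%N -> 0 <= t -> 0 <= t * a n.
  by move=> n1 t0; rewrite mulr_ge0// ltW// a0.
have sum_ord d (T : measurableType d) (P : probability T R) n (c : R)
    (F : nat -> T -> B) :
    P [set w | c < `|\sum_(1 <= i < n.+1) F i w|] =
    P [set w | c < `|\sum_(j < n) F j.+1 w|].
  by congr (P _); apply/seteqP; split=> w /=; rewrite big_add1 big_mkord.
split.
  move=> x xb d T P r r_rad n t n1 t0.
  have xbn (j : 'I_n) : `|x j.+1| <= psi n%:R.
    apply: le_trans (xb j.+1 _) _ => //; have := ltn_ord j.
    rewrite leq_eqVlt => /predU1P[->//|jn]; apply/ltW.
    by apply: increasing_nonneg_lt; rewrite ?ltr_nat.
  have [r_indep _ _] := r_rad.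
  have n_gt0 : 0 < n%:R :> R by rewrite ltr0n.
  have mscale (v : B) : measurable_fun setT (fun u : R => u *: v : borel B).
    apply: measurable_fun_borel => U oU; apply: open_measurable.
    by apply: open_comp => // u _; exact: scalel_continuous.
  rewrite (sum_ord _ _ P n (t * b n) (fun i w => r i w *: x i)).
  rewrite (sum_ord _ _ P n (t * a n) (fun i w => r i w *: rescale phi psi (x i))).
  rewrite (_ : P _ = P [set w | t * a n <
      `|\sum_(j < n) r j.+1 w *: ((a n / b n) *: x j.+1)|]); last first.
    congr (P _); apply/seteqP; split=> w /=; rewrite gt_rescale// scaler_sumr.
      by under eq_bigr do rewrite scalerA mulrC -scalerA.
    by under [in X in _ -> X]eq_bigr do rewrite scalerA mulrC -scalerA.
  apply: (symmetric_contraction B_separable (@oppr_measurable R setT)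
    (independent_family_ord r_indep)
    (fun j A => @rademacher_symmetric _ _ _ P r j.+1 A r_rad isT)
    (f := fun j u => u *: ((a n / b n) *: x j.+1))
    (g := fun j u => u *: rescale phi psi (x j.+1)) (ta_ge0 n t n1 t0)).
  - by move=> j; split=> [|u]; [exact: mscale|rewrite scaleNr].
  - by move=> j; split=> [|u]; [exact: mscale|rewrite scaleNr].
  move=> j u; have [k k01 xk] := scale_eq_rescale psi_cont phi_incr psi_incr
    phi0 psi0 phi_infty quot_nondecr n_gt0 (xbn j).
  by exists k => //; rewrite /a /b xk scalerA mulrC -scalerA.
move=> d T P V V_indep V_sym n t n1 t0.
(* Truncation secures the bound needed by [scale_eq_rescale] and keeps the map odd; a truncated
   value is matched by the factor 0. *)
pose trunc (v : B) : B := if `|v| <= b n then v else 0.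
have mnorm : measurable_fun setT (fun v : borel B => `|v : B| <= b n).
  have mle : measurable [set v : borel B | `|v : B| <= b n].
    rewrite -[X in measurable X]setCK; apply: measurableC.
    rewrite (_ : ~` _ = [set v : borel B | b n < `|v : B|]).
      by apply: (measurable_norm_gt _ (@measurable_id _ (borel B) setT)).
    by apply/seteqP; split=> v /=; rewrite ltNge => /negP.
  apply: (@measurable_fun_bool _ _ setT _ true).
  by rewrite setTI.
have mtrunc : measurable_fun setT
    ((fun v => (a n / b n) *: trunc v) : borel B -> borel B).
  apply: (@measurableT_comp _ _ _ _ _ _
    (fun v : borel B => (a n / b n) *: (v : B) : borel B)).
    by apply: continuous_measurable_borel; exact: scaler_continuous.
  by apply: measurable_fun_ifT.
rewrite (sum_ord _ _ P n (t * b n) V).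
rewrite (sum_ord _ _ P n (t * a n) (fun i w => rescale phi psi (V i w : B))).
have trunc_le :
  (P [set w | (t * a n < `|\sum_(j < n) (a n / b n) *: trunc (V j.+1 w)|)%R] <=
   2%:E * P [set w | (t * a n <
     `|\sum_(j < n) rescale phi psi (V j.+1 w : B)|)%R])%E.
  apply: (symmetric_contraction B_separable (E := borel B)
    (sigma := fun v => - (v : B))
    _ (independent_family_ord V_indep) _
    (f := fun j v => (a n / b n) *: trunc v)
    (g := fun j v => rescale phi psi v) (ta_ge0 n t n1 t0)).
  - by apply: continuous_measurable_borel; exact: opp_continuous.
  - by move=> j A mA; exact: V_sym.
  - move=> j; split=> // v.
    by rewrite /trunc normrN; case: ifP; rewrite ?scalerN ?oppr0// scaler0 oppr0.
  - move=> j; split=> [|v]; last exact: rescaleN.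
    apply: continuous_measurable_borel.
    exact: (rescale_continuous phi_nonneg psi_nonneg phi_cont psi_cont phi_incr
      psi_incr phi0 psi0 phi_infty quot_nondecr).
  - move=> j v; rewrite /trunc; case: ifP => vb.
      apply: (scale_eq_rescale psi_cont phi_incr psi_incr phi0 psi0 phi_infty
        quot_nondecr) => //.
      by rewrite ltr0n.
    by exists 0; rewrite ?lexx ?ler01// scaler0 scale0r.
have mF i : measurable [set w | (b n < `|V i w : B|)%R].
  by apply: measurable_norm_gt; exact: measurable_funPT.
pose E := [set w | t * a n < `|\sum_(j < n) (a n / b n) *: trunc (V j.+1 w)|].
pose F := \big[setU/set0]_(j < n) [set w | b n < `|V j.+1 w : B|].
have mE : measurable E.
  apply: measurable_norm_gt => //; apply: measurable_fun_sum => // j _.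
  by apply: (measurableT_comp mtrunc); exact: measurable_funPT.
have mF' : measurable F by exact: bigsetU_measurable.
(* Outside [F] no variable is truncated, so the scaled sum is the one in [E]. *)
have EF : [set w | t * b n < `|\sum_(j < n) (V j.+1 w : B)|] `<=` E `|` F.
  move=> w /=; rewrite gt_rescale// => tw.
  have [Fw|nFw] := pselect (F w); [by right|left].
  rewrite /E/=; rewrite scaler_sumr in tw.
  rewrite (eq_bigr (fun j : 'I_n => (a n / b n) *: (V j.+1 w : B)))// => j _.
  rewrite /trunc; case: leP => // Vw; exfalso; apply: nFw.
  rewrite /F -(bigcup_mkord n (fun j => [set w | b n < `|V j.+1 w : B|])).
  by exists j => /=.
apply: (@le_trans _ _ (P (E `|` F))).
  apply: le_measure; rewrite ?inE//.
    apply: measurable_norm_gt => //.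
    apply: (measurable_fun_sum B_separable (X := fun (j : 'I_n) w => V j.+1 w)).
    by move=> j _; exact: measurable_funPT.
  exact: measurableU.
apply: (le_trans (measureU2 _ mE mF')); apply: leeD; last first.
  rewrite big_add1 big_mkord.
  exact: (@Boole_inequality _ _ _ P (fun j => [set w | b n < `|V j.+1 w : B|])).
(* Contraction yields the constant 2, relaxed here to 4. *)
apply: (le_trans trunc_le); apply: lee_wpmul2r => //.
by rewrite lee_fin ler_nat.
Qed.
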